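(* There exists an absolute constant $c>0$ such that for every integer $n\ge 1$ the following holds. For every full-rank lattice $\Gamma\subset\mathbb{R}^n$ there exists an origin-symmetric convex body $K\subset\mathbb{R}^n$ such that every infinitely proper GAP $P$ in $\Gamma$ with $K\cap\Gamma\subseteq P$ satisfies $$|P|\ge (cn)^n\,|K\cap\Gamma|.$$
   Context: A convex body is a compact convex subset of $\mathbb{R}^n$ with nonempty interior; it is origin-symmetric if $K=-K$. A full-rank lattice $\Gamma\subset\mathbb{R}^n$ is the set of integer linear combinations of $n$ linearly independent vectors of $\mathbb{R}^n$. A (symmetric) generalized arithmetic progression (GAP) of rank $d$ in $\Gamma$ is a set of the form $P=\{Az : z\in\mathbb{Z}^d,\ |z_i|\le b_i,\ 1\le i\le d\}$, where $A\in\mathbb{R}^{n\times d}$ is a matrix with columns $a_1,\dots,a_d\in\Gamma$ and $b=(b_1,\dots,b_d)\in\mathbb{R}_{>0}^d$ (a GAP is considered together with the data $A,b$). It is proper if $z\mapsto Az$ is injective on $\{z\in\mathbb{Z}^d: |z_i|\le b_i,\ 1\le i\le d\}$. For $t>0$, $P_t$ denotes the GAP with the same matrix $A$ and with each $b_i$ replaced by $tb_i$. $P$ is infinitely proper if $P_t$ is proper for every $t>0$; equivalently, the columns of $A$ are $\mathbb{Z}$-linearly independent. The size of an infinitely proper GAP is $|P|=\prod_{i=1}^d(2\lfloor b_i\rfloor+1)$, which is its cardinality as a set. $|K\cap\Gamma|$ denotes cardinality. *)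

(* Defs.v *)
From HB Require Import structures.
From mathcomp Require Import all_boot all_order all_algebra finmap.
From mathcomp Require Import all_classical all_reals all_analysis.

Set Implicit Arguments.
Unset Strict Implicit.
Unset Printing Implicit Defensive.

Import Order.TTheory GRing.Theory Num.Theory.
Import numFieldNormedType.Exports.

Local Open Scope classical_set_scope.
Local Open Scope ring_scope.

Definition convex_body (R : realType) (n : nat) (K : set 'cV[R]_n) : Prop :=
  [/\ convex_set K, compact K & K° !=set0].

Definition origin_symmetric (R : realType) (n : nat) (K : set 'cV[R]_n) : Prop :=
  K = [set - x | x in K].

Definition full_rank_lattice (R : realType) (n : nat) (G : set 'cV[R]_n) : Prop :=
  exists v : n.-tuple 'cV[R]_n,
    free v /\ G = [set \sum_(i < n) tnth v i *~ z i | z in [set: 'I_n -> int]].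

Definition gap_box (R : realType) (d : nat) (b : 'cV[R]_d) : set 'cV[int]_d :=
  [set z : 'cV[int]_d | forall i, `|z i 0|%:~R <= b i 0].

Definition gap_map (R : realType) (n d : nat) (A : 'M[R]_(n, d))
    (z : 'cV[int]_d) : 'cV[R]_n :=
  A *m map_mx intr z.

(* A GAP is handled through its data (A, b); gap_set A b is the underlying
   set of points. *)
Definition gap_set (R : realType) (n d : nat) (A : 'M[R]_(n, d))
    (b : 'cV[R]_d) : set 'cV[R]_n :=
  gap_map A @` gap_box b.

Definition is_gap (R : realType) (n d : nat) (G : set 'cV[R]_n)
    (A : 'M[R]_(n, d)) (b : 'cV[R]_d) : Prop :=
  (forall j, G (col j A)) /\ (forall i, 0 < b i 0).

Definition gap_proper (R : realType) (n d : nat) (A : 'M[R]_(n, d))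
    (b : 'cV[R]_d) : Prop :=
  set_inj (gap_box b) (gap_map A).

Definition gap_infinitely_proper (R : realType) (n d : nat) (A : 'M[R]_(n, d))
    (b : 'cV[R]_d) : Prop :=
  forall t : R, 0 < t -> gap_proper A (t *: b).

Definition gap_size (R : realType) (d : nat) (b : 'cV[R]_d) : int :=
  \prod_(i < d) (2 * Num.floor (b i 0) + 1).

(* Main.v *)
Require Import Defs.
From HB Require Import structures.
From mathcomp Require Import all_boot all_order all_algebra finmap.
From mathcomp Require Import all_classical all_reals all_analysis.
From mathcomp Require Import lra.

Set Implicit Arguments.
Unset Strict Implicit.
Unset Printing Implicit Defensive.

Import Order.TTheory GRing.Theory Num.Theory.
Import numFieldNormedType.Exports.

Local Open Scope classical_set_scope.
Local Open Scope ring_scope.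

(** The body K is a cross-polytope: if the columns v_1, ..., v_n of V form a
    basis of the lattice, K is the set of all sum_i x_i v_i with
    sum_i |x_i| <= n. It is thin, but it contains n v_j for every j, and this
    forces any infinitely proper progression P that contains its lattice points
    to be long in n directions.

    Indeed v_j = A z_j and n v_j = A w_j for some z_j, w_j in the box of P.
    Infinite properness gives w_j = n z_j, so n |z_j i| <= b_i for every i: as
    z_j is integral, b_i >= n as soon as some z_j has a nonzero i-th coordinate.
    The z_j span a space of dimension n, because their images v_j do; hence at
    least n coordinates i are concerned, and |P| >= (2n+1)^n
    ([gap_size_ge_of_multiples]).

    On the other hand K has at most 8^n lattice points
    ([card_crosspolytope_lattice]): giving weight 2^-(sum_i |x_i|) to the
    integer vector x, each of them weighs at least 2^-n, while the total weight
    of Z^n is the n-th power of a convergent one-dimensional sum. Since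
    (2n+1)^n >= (n/4)^n 8^n, the constant c = 1/4 works. *)

(** * Cross-polytopes as convex bodies *)

Definition crosspolytope (R : realType) (n : nat) (V : 'M[R]_n) (r : R) :
    set 'cV[R]_n :=
  [set x | \sum_(i < n) `|(invmx V *m x) i 0| <= r].

(** A linear map out of a matrix space is such a combination of coordinates;
    this is how linear maps between spaces of matrices of different shapes are
    shown to be continuous below. *)
Lemma continuous_coord_comb (R : realType) (E : normedModType R) (m n : nat)
    (I : finType) (a : I -> 'I_m) (b : I -> 'I_n) (u : I -> E) :
  continuous (fun x : 'M[R]_(m, n) => \sum_(j : I) x (a j) (b j) *: u j).
Proof.
apply: continuous_big => [|j _]; first exact: add_continuous.
move=> x; apply: (@continuousZr_tmp _ _ _
  (fun x : 'M[R]_(m, n) => x (a j) (b j))).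
exact: coord_continuous.
Qed.

Lemma mulmx_col_comb (R : realType) (m n : nat) (W : 'M[R]_(m, n))
    (x : 'cV[R]_n) : W *m x = \sum_(j < n) x j 0 *: col j W.
Proof.
apply/colP => i; rewrite mxE summxE; apply: eq_bigr => j _.
by rewrite !mxE mulrC.
Qed.

Lemma continuous_l1norm (R : realType) (T : topologicalType) (m : nat)
    (f : 'I_m -> T -> R) :
  (forall i, continuous (f i)) -> continuous (fun x => \sum_(i < m) `|f i x|).
Proof.
move=> fc; apply: continuous_big => [|i _ x]; first exact: add_continuous.
by apply: cvg_norm; exact: fc.
Qed.

Lemma continuous_mulmx_l1norm (R : realType) (m n : nat) (W : 'M[R]_(m, n)) :
  continuous (fun x : 'cV[R]_n => \sum_(i < m) `|(W *m x) i 0|).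
Proof.
apply: continuous_l1norm => i.
have -> : (fun x : 'cV[R]_n => (W *m x) i 0) =
          (fun x : 'cV[R]_n => \sum_(j < n) x j 0 *: (W i j : R^o)).
  by apply/funext => y; rewrite mxE; apply: eq_bigr => j _; rewrite mulrC.
exact: continuous_coord_comb.
Qed.

Lemma crosspolytope_convex (R : realType) (n : nat) (V : 'M[R]_n) (r : R) :
  convex_set (crosspolytope V r).
Proof.
move=> x y k /set_mem /= xr /set_mem /= yr; apply/mem_set.
rewrite /crosspolytope /=.
have p0 : 0 <= k%:num by exact: ge0.
have p1 : 0 <= 1 - k%:num by rewrite subr_ge0; exact: le1.
set p := k%:num in p0 p1 *.
have -> : conv k x y = p *: (x : 'cV[R]_n) + (1 - p) *: (y : 'cV[R]_n) by [].
apply: (@le_trans _ _ (\sum_(i < n) (p * `|(invmx V *m x) i 0| +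
    (1 - p) * `|(invmx V *m y) i 0|))).
  apply: ler_sum => i _; rewrite mulmxDr -!scalemxAr 2!mxE.
  rewrite [X in `|_ + X|]mxE.
  by rewrite (le_trans (ler_normD _ _))// !normrM (ger0_norm p0) (ger0_norm p1).
rewrite big_split /= -!mulr_sumr.
rewrite /crosspolytope /= in xr yr; nra.
Qed.

(** Closed bounded sets of row vectors are compact, and the cross-polytope is the
    image of the l1 ball of row vectors under a continuous linear map. *)
Lemma crosspolytope_compact (R : realType) (n : nat) (V : 'M[R]_n) (r : R) :
  V \in unitmx -> compact (crosspolytope V r).
Proof.
move=> Vu.
pose S : set 'rV[R]_n := [set x | \sum_(i < n) `|x 0 i| <= r].
pose g (x : 'rV[R]_n) : 'cV[R]_n := \sum_(j < n) x 0 j *: col j V.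
have gE x : g x = V *m x^T.
  by rewrite mulmx_col_comb; apply: eq_bigr => j _; rewrite mxE.
have -> : crosspolytope V r = g @` S.
  apply/seteqP; split => [x xr|_ [x xr <-]].
    exists (invmx V *m x)^T; last by rewrite gE trmxK mulKVmx.
    rewrite /S /=; under eq_bigr do rewrite mxE; exact: xr.
  rewrite /crosspolytope /= gE mulKmx//.
  by under eq_bigr do rewrite mxE; exact: xr.
apply: continuous_compact.
  by apply/continuous_subspaceT; exact: continuous_coord_comb.
apply: bounded_closed_compact.
  exists r; split; first exact: num_real.
  move=> M rM x; rewrite /S /= => xr.
  have r0 : 0 <= r by rewrite (le_trans _ xr)// sumr_ge0.
  rewrite [leLHS]/Num.norm /= mx_normrE; apply: bigmax_le => [|[i j] _ /=].
    by rewrite (le_trans r0)// ltW.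
  rewrite ord1 (le_trans _ (le_trans xr (ltW rM)))//.
  by rewrite (bigD1 j)//= lerDl sumr_ge0.
rewrite (_ : S = (fun x : 'rV[R]_n => \sum_(i < n) `|x 0 i|) @^-1`
  [set y | y <= r])//.
apply: preimage_closed; last exact: closed_le.
move=> x _; move: x.
apply: continuous_l1norm => i; exact: coord_continuous.
Qed.

Lemma crosspolytope_body (R : realType) (n : nat) (V : 'M[R]_n) (r : R) :
  V \in unitmx -> 0 < r -> convex_body (crosspolytope V r).
Proof.
move=> Vu r0; split; first exact: crosspolytope_convex.
  exact: crosspolytope_compact.
exists 0; rewrite /interior /=.
apply: (@filterS _ _ _
  ((fun x : 'cV[R]_n => \sum_(i < n) `|(invmx V *m x) i 0|) @^-1`
     [set x | x < r])).
  by move=> x /= /ltW.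
apply: open_nbhs_nbhs; split.
  apply: open_comp => [x _|]; [exact: continuous_mulmx_l1norm|exact: open_lt].
by rewrite /= big1// => i _; rewrite mulmx0 mxE normr0.
Qed.

Lemma crosspolytope_symmetric (R : realType) (n : nat) (V : 'M[R]_n) (r : R) :
  origin_symmetric (crosspolytope V r).
Proof.
have opp_closed (x : 'cV[R]_n) : crosspolytope V r x -> crosspolytope V r (- x).
  rewrite /crosspolytope /= => xr; rewrite (le_trans _ xr)// ler_sum// => i _.
  by rewrite mulmxN mxE normrN.
apply/seteqP; split => [x xr|_ [x xr <-]]; last exact: opp_closed.
by exists (- x); [exact: opp_closed|rewrite opprK].
Qed.

(** * Lattice points of a cross-polytope *)

(** Linear independence of the generators is turned into invertibility of the
    matrix that has them as columns. *)
Lemma full_rank_lattice_basis (R : realType) (n : nat) (G : set 'cV[R]_n) :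
  full_rank_lattice G ->
  exists2 V : 'M[R]_n, V \in unitmx &
    G = [set V *m map_mx intr z | z in [set: 'cV[int]_n]].
Proof.
move=> [v [vfree ->]].
pose V : 'M[R]_n := \matrix_(i, j) tnth v j i 0.
have Vc (j : 'I_n) : col j V = tnth v j by apply/colP => i; rewrite !mxE.
exists V.
  rewrite -unitmx_tr -row_free_unit -kermx_eq0; apply/rowV0P => u.
  move/sub_kermxP => uV.
  have u0 := elimT freeP vfree (fun i => u 0 i).
  apply/rowP => i; rewrite mxE u0// {i}.
  transitivity (V *m u^T); last by rewrite -[V]trmxK -trmx_mul uV trmx0.
  rewrite mulmx_col_comb; apply: eq_bigr => j _.
  by rewrite mxE Vc (tnth_nth 0).
have key (z : 'cV[int]_n) :
    V *m map_mx intr z = \sum_(i < n) tnth v i *~ z i 0.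
  by rewrite mulmx_col_comb; apply: eq_bigr => j _; rewrite mxE Vc scaler_int.
apply/seteqP; split => [_ [z _ <-]|_ [z _ <-]].
  exists (\col_i z i) => //; rewrite key.
  by apply: eq_bigr => i _; rewrite mxE.
by exists (fun i => z i 0) => //; rewrite key.
Qed.

Lemma sum_half_pow_le2 (R : realFieldType) (m : nat) :
  \sum_(k < m) (2^-1 : R) ^+ k <= 2.
Proof.
(* The closed form of the geometric sum makes the induction go through. *)
suff -> : \sum_(k < m) (2^-1 : R) ^+ k = 2 - 2 * 2^-1 ^+ m.
  by rewrite gerDl oppr_le0 mulr_ge0// exprn_ge0// invr_ge0.
elim: m => [|m IH]; first by rewrite big_ord0 expr0 mulr1 subrr.
rewrite big_ord_recr /= IH exprS; lra.
Qed.

(** Weigh each [f] by the product over [i] of 2^-(f i).2. A function counted on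
    the left weighs at least 2^-r, and the total weight is the n-th power of a
    sum over one pair (sign, size), which is at most 2 + 2 = 4. *)
Lemma card_bounded_weight (n r : nat) :
  (#|[pred f : {ffun 'I_n -> bool * 'I_r.+1} | \sum_i (f i).2 <= r]|
     <= 2 ^ r * 4 ^ n)%N.
Proof.
pose w (s : bool * 'I_r.+1) : rat := 2^-1 ^+ s.2.
have w0 s : 0 <= w s by rewrite exprn_ge0// invr_ge0.
have w_sum : \sum_s w s <= 4.
  rewrite -(pair_bigA _ (fun (_ : bool) (k : 'I_r.+1) => (2^-1 : rat) ^+ k)) /=.
  rewrite big_bool /=.
  have := @sum_half_pow_le2 rat r.+1; lra.
rewrite -(ler_nat rat) natrM !natrX -ler_pdivrMl ?exprn_gt0// -exprVn.
rewrite mulr_natr -sumr_const.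
apply: (@le_trans _ _
    (\sum_(f : {ffun 'I_n -> bool * 'I_r.+1}) \prod_i w (f i))).
  rewrite [leRHS](bigID
    [pred f : {ffun 'I_n -> bool * 'I_r.+1} | \sum_i (f i).2 <= r]%N) /=.
  rewrite -[leLHS]addr0 lerD ?sumr_ge0// => [|f _]; last exact: prodr_ge0.
  apply: ler_sum => f; rewrite inE => fr.
  by rewrite prodrXr ler_wiXn2l// ?invr_ge0// invf_le1.
rewrite -(bigA_distr_bigA (fun _ s => w s)) prodr_const card_ord.
by rewrite lerXn2r ?nnegrE ?sumr_ge0.
Qed.

(** An integer vector is coded by the signs and the absolute values of its
    coordinates. Zero coordinates have two codes, but only an upper bound on the
    count is wanted, so it suffices that every lattice point has a code. *)
Lemma card_crosspolytope_lattice (R : realType) (n r : nat) (V : 'M[R]_n) :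
  V \in unitmx ->
  (#|` fset_set (crosspolytope V r%:R `&`
       [set V *m map_mx intr z | z in [set: 'cV[int]_n]])| <= 2 ^ r * 4 ^ n)%N.
Proof.
move=> Vu; set B := _ `&` _.
pose A := [pred f : {ffun 'I_n -> bool * 'I_r.+1} | (\sum_i (f i).2 <= r)%N].
pose g (f : {ffun 'I_n -> bool * 'I_r.+1}) : 'cV[R]_n :=
  V *m map_mx intr (\col_i ((-1) ^+ (f i).1 * ((f i).2 : nat)%:Z)).
pose F := [fset g f | f in A]%fset.
have BF : B `<=` [set` F].
  move=> x [xr [z _ xE]]; move: xr; rewrite -{x}xE /crosspolytope /= mulKmx//.
  under eq_bigr do rewrite mxE -intr_norm -abszE -pmulrn.
  rewrite -natr_sum ler_nat => zr.
  have zi i : (`|z i 0%R| < r.+1)%N.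
    by rewrite ltnS (leq_trans _ zr)// (bigD1 i)//= leq_addr.
  apply/imfsetP; exists [ffun i => (z i 0 < 0, inord `|z i 0%R|%N)] => /=.
    by rewrite inE; under eq_bigr do rewrite ffunE /= inordK//.
  rewrite /g; congr (_ *m map_mx _ _); apply/colP => i.
  by rewrite mxE ffunE /= inordK// -intEsign.
have FB : (fset_set B `<=` F)%fset.
  rewrite -[F]set_fsetK -fset_set_sub//.
  exact: sub_finite_set BF (finite_fset F).
apply: leq_trans (fsubset_leq_card FB) _.
apply: leq_trans (card_bounded_weight n r).
by rewrite (leq_trans (leq_imfset_card _ _ _))// -cardE.
Qed.

(** * Lower bound for the size of a progression *)

(** The rows of [Z] outside [S] vanish, so the product factors through a space of
    dimension #|S|. *)
Lemma mxrank_le_nonzero_rows (R : fieldType) (n d : nat)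
    (A : 'M[R]_(n, d)) (Z : 'M[R]_(d, n)) (S : pred 'I_d) :
  (forall i j, i \notin S -> Z i j = 0) -> (\rank (A *m Z) <= #|S|)%N.
Proof.
move=> ZS.
have -> : A *m Z = colsub (@enum_val _ S) A *m rowsub (@enum_val _ S) Z.
  apply/matrixP => i j; rewrite !mxE (bigID (mem S)) /= addrC.
  rewrite big1 ?add0r => [|k kS]; last by rewrite ZS ?mulr0.
  by rewrite big_enum_val; apply: eq_bigr => k _; rewrite !mxE.
exact: mulmx_max_rank.
Qed.

(** Containing both [v] and [r v] forces [b i >= r] in each direction [i] that the
    coordinates of [v] involve, and a basis involves at least [n] directions. *)
Lemma gap_size_ge_of_multiples (R : realType) (n r d : nat) (V : 'M[R]_n)
    (A : 'M[R]_(n, d)) (b : 'cV[R]_d) :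
  V \in unitmx -> (0 < r)%N -> (forall i, 0 < b i 0) ->
  gap_infinitely_proper A b ->
  (forall j, gap_set A b (col j V)) ->
  (forall j, gap_set A b (r%:R *: col j V)) ->
  (2 * r%:Z + 1) ^+ n <= gap_size b.
Proof.
move=> Vu r0 b0 Aproper PV PrV.
have r1 : 1 <= r%:R :> R by rewrite ler1n.
have /choice[z zP] : forall j : 'I_n, exists z : 'cV[int]_d,
    gap_map A z = col j V /\ forall i, z i 0 != 0 -> r%:R <= b i 0.
  move=> j; have [z zb zV] := PV j; have [w wb wV] := PrV j.
  exists z; split => // i zi0.
  (* Both [r z] and [w] lie in the box dilated by [r], where [A] is injective. *)
  have wE : r%:Z *: z = w.
    apply: (Aproper r%:R); first by rewrite ltr0n.
    - rewrite inE /gap_box /= => k; rewrite !mxE normrM intrM.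
      by rewrite ger0_norm// -pmulrn ler_wpM2l.
    - rewrite inE /gap_box /= => k; rewrite !mxE (le_trans (wb k))//.
      by rewrite ler_peMl// ltW.
    - rewrite wV -zV /gap_map scalemxAr; congr (_ *m _).
      by apply/colP => k; rewrite !mxE rmorphM.
  apply: le_trans (wb i); rewrite -wE mxE normrM intrM ger0_norm// -pmulrn.
  by rewrite ler_peMr// ler1z -gtz0_ge1 normr_gt0.
pose S := [pred i : 'I_d | r%:R <= b i 0].
pose Z : 'M[R]_(d, n) := \matrix_(i, j) (z j i 0)%:~R.
have AZ : A *m Z = V.
  apply/matrixP => i j; have [/colP/(_ i)] := zP j.
  by rewrite !mxE => <- _; apply: eq_bigr => k _; rewrite !mxE.
have nS : (n <= #|S|)%N.
  rewrite -[leqLHS](mxrank_unit Vu) -AZ; apply: mxrank_le_nonzero_rows => i j.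
  rewrite inE => bi; rewrite mxE; apply/eqP; rewrite intr_eq0.
  by apply: contraNT bi; apply: (zP j).2.
(* The directions outside [S] contribute factors that are at least 1. *)
rewrite /gap_size (bigID S) /= -[leLHS]mulr1.
have fl i : 0 <= Num.floor (b i 0) by rewrite floor_ge0 ltW.
have ge1 i : 1 <= 2 * Num.floor (b i 0) + 1.
  by rewrite lerDr mulr_ge0.
apply: ler_pM => //.
  apply: (@le_trans _ _ (\prod_(i in S) (2 * r%:Z + 1))).
    by rewrite prodr_const ler_weXn2l// lerDr mulr_ge0.
  apply: ler_prod => i; rewrite inE => rb.
  rewrite addr_ge0 ?mulr_ge0//= lerD2r ler_wpM2l//.
  by rewrite floor_ge_int.
by apply: (big_ind (fun x => 1 <= x)) => // x y; exact: mulr_ege1.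
Qed.

(* fset_set sends infinite sets to fset0; here it is applied to K `&` G, which
   is finite since it is contained in the finite set gap_set A b. *)
Theorem theorem1p5 (R : realType) :
  exists c : R, 0 < c /\
    forall n : nat, (1 <= n)%N ->
    forall G : set 'cV[R]_n, full_rank_lattice G ->
    exists K : set 'cV[R]_n,
      [/\ convex_body K, origin_symmetric K &
        forall (d : nat) (A : 'M[R]_(n, d)) (b : 'cV[R]_d),
          is_gap G A b -> gap_infinitely_proper A b ->
          K `&` G `<=` gap_set A b ->
          (c * n%:R) ^+ n * (#|` fset_set (K `&` G)|)%:R <= (gap_size b)%:~R].
Proof.
exists 4^-1; split; first by rewrite invr_gt0.
move=> n n0 G /full_rank_lattice_basis[V Vu ->].
exists (crosspolytope V n%:R); split.
- by apply: crosspolytope_body; rewrite ?ltr0n.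
- exact: crosspolytope_symmetric.
move=> d A b [_ b0] Aproper KP.
have KV (k : nat) (j : 'I_n) : (k <= n)%N -> gap_set A b (k%:R *: col j V).
  move=> kn; apply: KP; split.
    rewrite /crosspolytope /= colE scalemxAr mulKmx//.
    rewrite (bigD1 j)//= big1 => [|i ij].
      by rewrite !mxE eqxx mulr1 addr0 normr_nat ler_nat.
    by rewrite !mxE (negbTE ij) mulr0 normr0.
  exists (k%:Z *: delta_mx j 0) => //.
  apply/colP => i; rewrite !mxE (bigD1 j)//= big1 => [|l lj].
    by rewrite !mxE !eqxx mulr1 addr0 mulrC.
  by rewrite !mxE (negbTE lj) mulr0 mulr0.
have sizeP : (2 * n%:Z + 1) ^+ n <= gap_size b.
  apply: (gap_size_ge_of_multiples Vu n0 b0 Aproper) => j; last exact: KV.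
  by rewrite -[col j V]scale1r; exact: (KV 1%N).
have card8 := card_crosspolytope_lattice n Vu.
apply: (@le_trans _ _ ((2 * n%:R + 1) ^+ n)); last first.
  by move: sizeP; rewrite -(ler_int R) rmorphXn /= rmorphD rmorphM.
apply: (@le_trans _ _ ((4^-1 * n%:R) ^+ n * (8 ^+ n))).
  rewrite ler_wpM2l ?exprn_ge0 ?mulr_ge0 ?invr_ge0//.
  by rewrite -natrX ler_nat (leq_trans card8)// -expnMn.
rewrite -exprMn lerXn2r ?nnegrE ?mulr_ge0 ?addr_ge0 ?mulr_ge0 ?invr_ge0//.
by lra.
Qed.
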